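(* For all integers $0\le k\le n$ and every real $x$, $$B_k^n(x)=\frac{1}{n+1}\left((k+1)B_{k+1}^{n+1}(x)+(n+1-k)B_k^{n+1}(x)\right),$$ where $B_k^n$ denotes the Bernstein basis function.
   Context: The Bernstein basis functions are $B_k^n(x)=\binom{n}{k}x^k(1-x)^{n-k}$ for integers $0\le k\le n$ (with $0^0=1$). *)

(* Defs.v *)
From mathcomp Require Import all_boot all_order all_algebra.
From mathcomp Require Import reals.

Set Implicit Arguments.
Unset Strict Implicit.
Unset Printing Implicit Defensive.

Import GRing.Theory.
Local Open Scope ring_scope.

(* B_k^n(x).  [x ^+ 0] is 1 for every x, so 0^0 = 1.  For k > n the truncated
   exponent is harmless because the binomial coefficient is 0. *)
Definition bernstein (R : realType) (n k : nat) (x : R) : R :=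
  'C(n, k)%:R * x ^+ k * (1 - x) ^+ (n - k).

(* Main.v *)
(** The absorption identities [(k+1) C(n+1,k+1) = (n+1) C(n,k) = (n+1-k) C(n+1,k)]
    turn the bracket into [(n+1) B_k^n(x) (x + (1-x))]. *)
Require Import Defs.
From mathcomp Require Import all_boot all_order all_algebra.
From mathcomp Require Import reals.

Set Implicit Arguments.
Unset Strict Implicit.
Unset Printing Implicit Defensive.

Import GRing.Theory.
Local Open Scope ring_scope.

(** Degree elevation: split $B_k^n = xB_k^n + (1-x)B_k^n$. A factor $x$ or $1-x$ raises one
    exponent, so each piece is a multiple of one basis function of degree $n+1$
    ([bernstein_absorb_up], [bernstein_absorb_down]). *)

Lemma bernstein_absorb_up (R : realType) (n k : nat) (x : R) :
  (k%:R + 1) * bernstein n.+1 k.+1 x = (n%:R + 1) * (x * bernstein n k x).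
Proof.
rewrite /bernstein subSS !mulrA !natr1 -natrM -mul_bin_diag natrM exprS.
by rewrite !mulrA -!(mulrAC _ x).
Qed.

Lemma bernstein_absorb_down (R : realType) (n k : nat) (x : R) :
  (k <= n)%N ->
  (n%:R + 1 - k%:R) * bernstein n.+1 k x
    = (n%:R + 1) * ((1 - x) * bernstein n k x).
Proof.
(* Here [lekn] makes truncated subtraction exact: [n.+1 - k] is [(n - k).+1], which frees one factor
   [1 - x]. *)
move=> lekn; rewrite /bernstein natr1 -natrB ?leqW // subSn // exprSr !mulrA.
(* [subSn] also changed the coefficient; it is restored to [n.+1 - k] to fit [mul_bin_down]. *)
by rewrite -natrM -subSn // -mul_bin_down natrM /= -!(mulrAC _ (1 - x)).
Qed.

Theorem mainTheorem11 (R : realType) (n k : nat) (hkn : (k <= n)%N) (x : R) :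
  bernstein n k x =
    1 / (n%:R + 1) *
      ((k%:R + 1) * bernstein n.+1 k.+1 x
       + (n%:R + 1 - k%:R) * bernstein n.+1 k x).
Proof.
(* The weights collapse by [x + (1 - x) = 1], leaving [n%:R + 1] to cancel. *)
rewrite bernstein_absorb_up bernstein_absorb_down // -mulrDr -mulrDl subrKC.
by rewrite !mul1r mulKf // natr1 Num.Theory.pnatr_eq0.
Qed.
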